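(* Let $K$ be a field, $S=K[t_1,\ldots,t_s]$, and let $D$ be a weighted oriented graph with vertex set $V(D)=\{t_1,\ldots,t_s\}$ in which every source has weight $1$. Let $J(D)\subset S$ be the dual of the edge ideal $I(D)$ of $D$. Then $J(D)^2=J(D)^{(2)}$ if and only if the following two conditions hold: (i) every vertex in $V^+(D)$ is a sink; (ii) the underlying graph $G$ of $D$ is bipartite.
   Context: A weighted oriented graph $D=(V(D),E(D),w)$ with underlying simple graph $G$ (vertex set $V(G)=V(D)=\{t_1,\ldots,t_s\}$) is given by a choice of exactly one direction for each edge of $G$ (so $E(D)\subset V(D)\times V(D)$, $|E(D)|=|E(G)|$, and $E(G)$ is the set of pairs $\{t_i,t_j\}$ with $(t_i,t_j)\in E(D)$), together with a weight function $w\colon V(D)\to\{1,2,\ldots\}$; write $w_i=w(t_i)$. An edge $(t_i,t_j)$ is directed from $t_i$ to $t_j$. A source is a vertex with only outgoing edges; a sink is a vertex with only incoming edges. $V^+(D)$ is the set of vertices $t_i$ with $w_i>1$. The edge ideal of $D$ is $I(D):=(\{t_it_j^{w_j}\mid (t_i,t_j)\in E(D)\})$ and its dual is $J(D):=\bigcap_{(t_i,t_j)\in E(D)}(t_i,t_j^{w_j})$. For an ideal $I\subset S$ and $n\geq 1$, the $n$-th symbolic power is $I^{(n)}:=\bigcap_{\mathfrak{p}\in\mathrm{minAss}(I)}(I^nS_{\mathfrak{p}}\cap S)$, where $\mathrm{minAss}(I)$ is the set of inclusion-minimal associated primes of $I$. *)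

(* Defs.v *)
From HB Require Import structures.
From mathcomp Require Import all_boot all_order all_algebra.
From mathcomp Require Import fraction.
From mathcomp Require Import mpoly.

Set Implicit Arguments.
Unset Strict Implicit.
Unset Printing Implicit Defensive.

Import GRing.Theory.
Local Open Scope ring_scope.

(* Ideals are Prop-valued predicates on the ring, compared by the pointwise
   relations [ideal_le] and [ideal_eq]. *)

Definition is_ideal (R : comNzRingType) (I : R -> Prop) : Prop :=
  [/\ I 0,
      forall x y, I x -> I y -> I (x + y)
    & forall a x, I x -> I (a * x)].

Definition ideal_le (R : comNzRingType) (I J : R -> Prop) : Prop :=
  forall x, I x -> J x.

Definition ideal_eq (R : comNzRingType) (I J : R -> Prop) : Prop :=
  forall x, I x <-> J x.

Definition ideal_gen (R : comNzRingType) (A : R -> Prop) : R -> Prop :=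
  fun x => exists (n : nat) (a b : 'I_n -> R),
    (forall i, A (b i)) /\ x = \sum_(i < n) a i * b i.

Definition ideal_mul (R : comNzRingType) (I J : R -> Prop) : R -> Prop :=
  ideal_gen (fun z => exists x y, [/\ I x, J y & z = x * y]).

Definition ideal_pow (R : comNzRingType) (I : R -> Prop) (n : nat) : R -> Prop :=
  iter n (ideal_mul I) (fun=> True).

Definition ideal_colon (R : comNzRingType) (I : R -> Prop) (f : R) : R -> Prop :=
  fun g => I (g * f).

Definition prime_ideal (R : comNzRingType) (P : R -> Prop) : Prop :=
  [/\ is_ideal P, ~ P 1 & forall x y, P (x * y) -> P x \/ P y].

(* The associated primes of I are those of the module R / I: the prime
   annihilators (I : f) of the residue classes of elements f of R. *)
Definition associated_prime (R : comNzRingType) (I P : R -> Prop) : Prop :=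
  prime_ideal P /\ exists f : R, ideal_eq P (ideal_colon I f).

Definition min_associated_prime (R : comNzRingType) (I P : R -> Prop) : Prop :=
  associated_prime I P /\
  forall Q : R -> Prop, associated_prime I Q -> ideal_le Q P -> ideal_le P Q.

(* For a domain R, the localization R_P is realized as the subring of the
   fraction field of R formed by the fractions with denominator outside P. *)
Definition localization (R : idomainType) (P : R -> Prop) :
    {fraction R} -> Prop :=
  fun z => exists a b : R, ~ P b /\ z = tofrac a / tofrac b.

(* The extension I R_P of an ideal I of R, as a subset of the fraction field. *)
Definition extended_ideal (R : idomainType) (P I : R -> Prop) :
    {fraction R} -> Prop :=
  fun z => exists (n : nat) (a : 'I_n -> {fraction R}) (x : 'I_n -> R),
    [/\ forall i, localization P (a i),
        forall i, I (x i)
      & z = \sum_(i < n) a i * tofrac (x i)].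

Definition symbolic_power (R : idomainType) (I : R -> Prop) (n : nat) :
    R -> Prop :=
  fun f => forall P : R -> Prop, min_associated_prime I P ->
    extended_ideal P (ideal_pow I n) (tofrac f).

(* Asymmetry of [arc] makes it irreflexive: the underlying graph is simple and
   each of its edges carries exactly one direction. *)
Record wograph (s : nat) := WOGraph {
  arc : rel 'I_s;
  weight : 'I_s -> nat;
  arc_asym : forall i j, arc i j -> ~~ arc j i;
  weight_gt0 : forall i, (0 < weight i)%N }.

Definition underlying (s : nat) (D : wograph s) : rel 'I_s :=
  fun i j => arc D i j || arc D j i.

(* An isolated vertex is both a source and a sink. *)
Definition is_source (s : nat) (D : wograph s) (i : 'I_s) : Prop :=
  forall j, ~~ arc D j i.

Definition is_sink (s : nat) (D : wograph s) (i : 'I_s) : Prop :=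
  forall j, ~~ arc D i j.

Definition Vplus (s : nat) (D : wograph s) : {set 'I_s} :=
  [set i | (1 < weight D i)%N].

Definition bipartite (T : finType) (e : rel T) : Prop :=
  exists A : {set T}, forall i j, e i j -> (i \in A) != (j \in A).

Definition edge_ideal (K : fieldType) (s : nat) (D : wograph s) :
    {mpoly K[s]} -> Prop :=
  ideal_gen (fun f => exists i j, arc D i j /\ f = 'X_i * 'X_j ^+ weight D j).

(* The dual of [edge_ideal K D]. *)
Definition dual_ideal (K : fieldType) (s : nat) (D : wograph s) :
    {mpoly K[s]} -> Prop :=
  fun f => forall i j, arc D i j ->
    ideal_gen (fun g => g = 'X_i \/ g = 'X_j ^+ weight D j) f.

Arguments edge_ideal : clear implicits.
Arguments dual_ideal : clear implicits.

(* Main.v *)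
Require Import Defs.
From mathcomp Require Import all_boot all_order all_algebra.
From mathcomp Require Import fraction.
From mathcomp Require Import mpoly.
From mathcomp Require Import zify ring.
From Stdlib Require Import ClassicalEpsilon.

Set Implicit Arguments.
Unset Strict Implicit.
Unset Printing Implicit Defensive.

Import GRing.Theory.
Local Open Scope ring_scope.

(** All ideals in sight are monomial, so the theorem becomes a question about
exponent vectors.  The ideal [J] is spanned by the monomials whose exponent [m]
is a weighted cover ([wcover]): for every arc [(a, b)], either [m a >= 1] or
[m b >= w b].  Hence [J^2] is spanned by the sums of two weighted covers.

The associated primes of [J] are the ideals [(X_a, X_b)] of the arcs, all of
them minimal ([min_associated_primeP]).  Localizing at one of them makes the
constraints of the other arcs void, and the square of [(X_a, X_b^w)] is primary
([monomial_ideal_primary]); the second symbolic power is therefore spanned by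
the exponents with [m a + m b %/ w b >= 2] for every arc ([symbolic_square]),
called double covers here.  So [J^2 = J^(2)] holds exactly when every double
cover is a sum of two covers.

If a vertex [j] of weight at least two is not a sink, it is not a source either,
and a walk [i -> j -> k], or the walk [k -> i -> j] on some directed triangles,
carries a double cover that is not such a sum ([walk_obstruction]).  If all
vertices of weight at least two are sinks, a decomposition of the
double cover [w] yields a proper two-colouring of the graph
([bipartite_of_split]); conversely a two-colouring tells how to round when a
double cover is divided by two ([split_of_bipartite]). *)

(** * Ideals, their products and localizations *)

Section Ideals.

Variable R : comNzRingType.
Implicit Types (I J A P : R -> Prop).

Lemma ideal_sum I (T : Type) (r : seq T) (Q : pred T) (F : T -> R) :
  is_ideal I -> (forall i, Q i -> I (F i)) -> I (\sum_(i <- r | Q i) F i).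
Proof. by move=> [I0 ID _] IF; apply: big_ind. Qed.

Lemma ideal_sum_seq I (T : eqType) (r : seq T) (F : T -> R) :
  is_ideal I -> (forall i, i \in r -> I (F i)) -> I (\sum_(i <- r) F i).
Proof. by move=> hI IF; rewrite big_seq; apply: ideal_sum. Qed.

Lemma ideal_genP A : is_ideal (ideal_gen A).
Proof.
split.
- exists 0%N, (fun=> 0), (fun=> 0); split; first by case.
  by rewrite big_ord0.
- move=> _ _ [m [a [b [Ab ->]]]] [n [c [d [Ad ->]]]].
  exists (m + n)%N.
  exists (fun i => match split i with inl j => a j | inr j => c j end).
  exists (fun i => match split i with inl j => b j | inr j => d j end).
  split; first by move=> i; case: (split i).
  rewrite big_split_ord; congr (_ + _); apply: eq_bigr => i _.
    by rewrite (unsplitK (inl i)).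
  by rewrite (unsplitK (inr i)).
move=> u _ [n [a [b [Ab ->]]]].
exists n, (fun i => u * a i), b; split=> //.
by rewrite mulr_sumr; apply: eq_bigr => i _; rewrite mulrA.
Qed.

Lemma mem_ideal_gen A x : A x -> ideal_gen A x.
Proof.
move=> Ax; exists 1%N, (fun=> 1), (fun=> x); split=> //.
by rewrite big_ord1 mul1r.
Qed.

Lemma ideal_gen_le A I : is_ideal I -> ideal_le A I -> ideal_le (ideal_gen A) I.
Proof.
move=> hI AI _ [n [a [b [Ab ->]]]].
by apply: ideal_sum => // i _; case: hI => _ _; apply; apply: AI.
Qed.

Lemma ideal_powP I n : is_ideal (ideal_pow I n).
Proof. by case: n => [|n]; [split | apply: ideal_genP]. Qed.

Lemma mem_ideal_sqr I x y : I x -> I y -> ideal_pow I 2 (x * y).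
Proof.
move=> Ix Iy; apply: mem_ideal_gen; exists x, y; split=> //.
apply: mem_ideal_gen; exists y, 1; split=> //; first by rewrite mulr1.
Qed.

Lemma ideal_sqr_le I J : is_ideal I -> is_ideal J ->
  (forall x y, I x -> I y -> J (x * y)) -> ideal_le (ideal_pow I 2) J.
Proof.
move=> hI hJ IJ; apply: ideal_gen_le => // _ [x [y [Ix Iy ->]]].
apply: IJ => //; move: y Iy; apply: ideal_gen_le => // _ [y [z [Iy _ ->]]].
by rewrite mulrC; case: hI => _ _; apply.
Qed.

Lemma prime_ideal_prod P (T : Type) (r : seq T) (F : T -> R) :
  prime_ideal P -> (forall i, ~ P (F i)) -> ~ P (\prod_(i <- r) F i).
Proof.
move=> [_ P1 PM] PF.
by apply: (big_ind (fun x => ~ P x)) => // x y Px Py /PM[].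
Qed.

Lemma prime_ideal_exp P x n : prime_ideal P -> P (x ^+ n) -> P x.
Proof.
move=> [_ P1 PM]; elim: n => [|n IHn]; first by rewrite expr0 => /P1.
by rewrite exprS => /PM[].
Qed.

End Ideals.

(** Clearing denominators turns extension to the local ring at [P] and
contraction back to [R] into a saturation of [I], which no longer mentions
fractions. *)
Lemma extended_idealP (R : idomainType) (P I : R -> Prop) (f : R) :
  prime_ideal P -> is_ideal I ->
  extended_ideal P I (tofrac f) <-> exists2 b, ~ P b & I (b * f).
Proof.
move=> primeP hI; have [[P0 _ _] P1 PM] := primeP.
have [I0 ID IM] := hI.
have nz b : ~ P b -> tofrac b != 0.
  by move=> Pb; rewrite tofrac_eq0; apply: contra_notN Pb => /eqP->.
split=> [[n [a [x [Pa Ix fE]]]]|[b Pb Ibf]].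
  suff [b Pb [c Ic bcE]] : exists2 b, ~ P b & exists2 c, I c &
      tofrac b * \sum_(i < n) a i * tofrac (x i) = tofrac c.
    exists b => //; move: bcE; rewrite -fE -tofracM => /eqP.
    by rewrite tofrac_eq => /eqP->.
  apply: (big_ind (fun z => exists2 b, ~ P b & exists2 c, I c &
      tofrac b * z = tofrac c)) => [|y z|i _].
  - by exists 1 => //; exists 0 => //; rewrite mulr0 tofrac0.
  - move=> [b Pb [c Ic bE]] [d Pd [e Ie dE]].
    exists (b * d); first by move=> /PM[].
    exists (d * c + b * e); first by apply: ID; apply: IM.
    by rewrite tofracD !tofracM -bE -dE mulrDr mulrCA !mulrA [_ * tofrac d]mulrC.
  - have [u [v [Pv ->]]] := Pa i.
    exists v => //; exists (u * x i); first exact: IM.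
    by rewrite tofracM mulrA mulrCA divff ?nz // mulr1.
exists 1%N, (fun=> 1 / tofrac b), (fun=> b * f); split=> // [_|].
  by exists 1, b; rewrite tofrac1.
by rewrite big_ord1 mul1r tofracM mulKf ?nz.
Qed.

(** * Monomial ideals *)

Section MonomialIdeals.

Variables (K : fieldType) (n : nat).
Implicit Types (U V : 'X_{1..n} -> Prop) (f g : {mpoly K[n]}) (m : 'X_{1..n}).

Definition up_closed U := forall m k, U m -> U (k + m)%MM.

(** For an up-closed [U] this is the ideal spanned over [K] by the monomials
with exponent in [U]. *)
Definition monomial_ideal U f := forall m, m \in msupp f -> U m.

Lemma monomial_idealP U : up_closed U -> is_ideal (monomial_ideal U).
Proof.
move=> upU; split=> [m|f g Uf Ug m|a f Uf m]; first by rewrite msupp0.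
  by move/msuppD_le; rewrite mem_cat => /orP[/Uf|/Ug].
by move/msuppM_le => /allpairsP[[k l] /= [_ /Uf Ul ->]]; apply: upU.
Qed.

Lemma monomial_ideal_X U m : monomial_ideal U 'X_[m] <-> U m.
Proof.
split=> [|Um k]; first by apply; rewrite msuppX inE.
by rewrite msuppX inE => /eqP->.
Qed.

Lemma monomial_ideal_le U (I : {mpoly K[n]} -> Prop) :
  is_ideal I -> (forall m, U m -> I 'X_[m]) -> ideal_le (monomial_ideal U) I.
Proof.
move=> hI UI f Uf; rewrite (mpolyE f); apply: ideal_sum_seq => // m /Uf/UI Im.
by rewrite -mul_mpolyC; case: hI => _ _; apply.
Qed.

Definition sumset U m := exists m1 m2, [/\ U m1, U m2 & m = (m1 + m2)%MM].

Lemma monomial_ideal_sqr (I : {mpoly K[n]} -> Prop) U :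
  up_closed U -> ideal_eq I (monomial_ideal U) ->
  ideal_eq (ideal_pow I 2) (monomial_ideal (sumset U)).
Proof.
move=> upU IU; have [U0 UD UM] := monomial_idealP upU.
have idI : is_ideal I.
  split=> [|x y /IU Ux /IU Uy|a x /IU Ux]; apply/IU => //; [exact: UD|exact: UM].
move=> f; split; move: f.
  apply: ideal_sqr_le => //.
    apply: monomial_idealP => m k [m1 [m2 [U1 U2 ->]]].
    by exists (k + m1)%MM, m2; split; [apply: upU | | rewrite addmA].
  move=> f g /IU Uf /IU Ug m /msuppM_le/allpairsP[[k l] /= [/Uf Uk /Ug Ul ->]].
  by exists k, l.
apply: monomial_ideal_le; first exact: ideal_powP.
move=> _ [m1 [m2 [U1 U2 ->]]]; rewrite mpolyXD.
by apply: mem_ideal_sqr; apply/IU/monomial_ideal_X.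
Qed.

Lemma monomial_ideal_colonX (I : {mpoly K[n]} -> Prop) U m f :
  ideal_eq I (monomial_ideal U) ->
  ideal_colon I 'X_[m] f <-> monomial_ideal (fun k => U (m + k)%MM) f.
Proof.
move=> IU; rewrite /ideal_colon IU; split=> [Uf k fk|Uf k].
  by apply: Uf; rewrite (perm_mem (msuppMX _ _)) map_f.
by rewrite (perm_mem (msuppMX _ _)) => /mapP[l /Uf Ul ->].
Qed.

Lemma monomial_ideal_gen2 (i j : 'I_n) (w : nat) :
  ideal_eq (ideal_gen (fun g : {mpoly K[n]} => g = 'X_i \/ g = 'X_j ^+ w))
           (monomial_ideal (fun m => (0 < m i)%N || (w <= m j)%N)).
Proof.
move=> f; split; move: f.
  apply: ideal_gen_le => [|_ [->|->]].
  - by apply: monomial_idealP => m k; rewrite !mnmDE; lia.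
  - by apply/monomial_ideal_X; rewrite mnm1E eqxx.
  - rewrite mpolyXn; apply/monomial_ideal_X.
    by rewrite !mulmnE !mnm1E eqxx mul1n leqnn orbT.
apply: monomial_ideal_le; first exact: ideal_genP.
have [_ _ idM] := ideal_genP (fun g : {mpoly K[n]} => g = 'X_i \/ g = 'X_j ^+ w).
move=> m /orP[mi|mj].
- have -> : m = (m - U_(i) + U_(i))%MM.
    by apply/mnmP => v; rewrite mnmDE mnmBE mnm1E; case: eqP => [<-|_]; lia.
  by rewrite mpolyXD; apply/idM/mem_ideal_gen; left.
- have -> : m = (m - U_(j) *+ w + U_(j) *+ w)%MM.
    apply/mnmP => v; rewrite mnmDE mnmBE mulmnE mnm1E.
    by case: eqP => [<-|_]; lia.
  by rewrite mpolyXD -mpolyXn; apply/idM/mem_ideal_gen; right.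
Qed.

Definition truncate (Q : pred 'X_{1..n}) f : {mpoly K[n]} :=
  \sum_(m <- msupp f | Q m) f@_m *: 'X_[m].

Lemma msupp_truncate Q f m : m \in msupp (truncate Q f) -> Q m /\ m \in msupp f.
Proof.
move=> /msupp_sum_le/flattenP[s /mapP[k]].
rewrite mem_filter => /andP[Qk fk] -> /msuppZ_le.
by rewrite msuppX inE => /eqP->.
Qed.

Lemma truncateC Q f : f = truncate Q f + truncate (predC Q) f.
Proof. by rewrite {1}(mpolyE f) (bigID Q). Qed.

Lemma truncate_neq0 (Q : pred 'X_{1..n}) f :
  ~ monomial_ideal (fun m => ~~ Q m) f -> truncate Q f != 0.
Proof.
move=> nQf; apply/eqP => Qf0; apply: nQf => m.
by rewrite (truncateC Q f) Qf0 add0r => /msupp_truncate[].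
Qed.

Section VariablePrime.

Variable A : {set 'I_n}.

Definition mdeg_in m := (\sum_(v in A) m v)%N.

Lemma mdeg_inD m k : mdeg_in (m + k)%MM = (mdeg_in m + mdeg_in k)%N.
Proof. by rewrite -big_split; apply: eq_bigr => v _; rewrite mnmDE. Qed.

Lemma mdeg_in_eq0 m v : mdeg_in m = 0%N -> v \in A -> m v = 0%N.
Proof. by move/eqP; rewrite sum_nat_eq0 => /forall_inP h /h/eqP. Qed.

(** The prime generated by the variables in [A]. *)
Definition variable_prime := monomial_ideal (fun m => (0 < mdeg_in m)%N).

Lemma variable_primeP : is_ideal variable_prime.
Proof. by apply: monomial_idealP => m k; rewrite mdeg_inD; lia. Qed.

(** This says that a monomial ideal in the variables of [A] is either the unit
ideal or primary for the prime these variables generate.  Comparing only the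
part of [b] free of these variables with the part of [f] outside the ideal of
least degree in them, the product of the two parts is nonzero, and the other
products cannot cancel it. *)
Lemma monomial_ideal_primary (U : pred 'X_{1..n}) b f :
  up_closed (fun m => U m) ->
  (forall m k : 'X_{1..n}, (forall v, v \in A -> m v = k v) -> U m = U k) ->
  ~ variable_prime b -> monomial_ideal (fun m => U m) (b * f) ->
  monomial_ideal (fun m => U m) f.
Proof.
move=> upU UA Pb Ubf; apply: NNPP => nUf.
(* The degrees in [A] of the monomials of [f] outside the ideal. *)
pose bad (d : nat) := has (fun m => ~~ U m && (mdeg_in m == d)) (msupp f).
have exbad : exists d, bad d.
  apply: NNPP => nbad; apply: nUf => m fm; apply: contra_notT nbad => Um.
  by exists (mdeg_in m); apply/hasP; exists m; rewrite ?Um ?eqxx.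
case: (ex_minnP exbad) => d /hasP[m0 fm0 /andP[Um0 /eqP dm0]] dmin.
pose Qb m := mdeg_in m == 0%N.
pose Qf m := ~~ U m && (mdeg_in m == d).
pose W m := U m || (d < mdeg_in m)%N.
(* Modulo the monomials in [W], [b * f] agrees with the product of its two
   chosen parts, and no monomial of that product is in [W]. *)
have upW : up_closed (fun m => W m).
  move=> m k /orP[/upU Um|dm]; apply/orP; first by left; apply: Um.
  by right; rewrite mdeg_inD; lia.
have idW := monomial_idealP upW.
have [_ WD WM] := idW.
have Wf1 : monomial_ideal (fun m => W m) (truncate (predC Qf) f).
  move=> m /msupp_truncate[/= Qm fm]; rewrite /W.
  move: Qm; rewrite negb_and negbK => /orP[->//|dm].
  case: (boolP (U m)) => //= Um.
  have : bad (mdeg_in m) by apply/hasP; exists m; rewrite // Um eqxx.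
  by move/dmin; rewrite leq_eqVlt eq_sym (negPf dm).
have Wb1f0 : monomial_ideal (fun m => W m) (truncate (predC Qb) b * truncate Qf f).
  move=> m /msuppM_le/allpairsP[[k l] /= [/msupp_truncate[/= kb _]]].
  move=> /msupp_truncate[/andP[_ /eqP ld] _] ->.
  by apply/orP; right; rewrite mdeg_inD; move: kb; rewrite /Qb /=; lia.
have Wb0f0 : monomial_ideal (fun m => W m) (truncate Qb b * truncate Qf f).
  have -> : truncate Qb b * truncate Qf f =
      b * f + (-1) * (b * truncate (predC Qf) f
                      + truncate (predC Qb) b * truncate Qf f).
    have := truncateC Qf f; set f0 := truncate Qf f; set f1 := truncate _ f => fE.
    have := truncateC Qb b; set b0 := truncate Qb b; set b1 := truncate _ b => bE.
    by rewrite fE bE; ring.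
  apply: (WD); first by move=> m /Ubf Um; rewrite /W Um.
  by apply: (WM); apply: (WD) => //; apply: WM.
have : truncate Qb b * truncate Qf f != 0.
  rewrite mulf_neq0 ?truncate_neq0 //.
    by move=> Qbb; apply: Pb => m /Qbb /=; rewrite /Qb; lia.
  by move/(_ m0 fm0); rewrite /= /Qf Um0 dm0 eqxx.
rewrite -msupp_eq0; case E: (msupp _) => [//|m s] _.
have ms : m \in msupp (truncate Qb b * truncate Qf f) by rewrite E mem_head.
have := Wb0f0 m ms; move/msuppM_le: ms => /allpairsP[[k l] /=].
move=> [/msupp_truncate[/eqP kb _] /msupp_truncate[/andP[Ul /eqP ld] _] ->].
rewrite /W mdeg_inD kb ld ltnn orbF (UA _ l) ?(negPf Ul) // => v vA.
by rewrite mnmDE (mdeg_in_eq0 kb vA).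
Qed.

Lemma variable_prime_prime : prime_ideal variable_prime.
Proof.
split=> [||x y Pxy]; first exact: variable_primeP.
  move/(_ 0%MM); rewrite -mpolyC1 msupp1 mem_head /mdeg_in => /(_ isT).
  by rewrite big1 // => v _; rewrite mnm0E.
case: (classic (variable_prime x)) => [|Px]; [by left | right].
apply: monomial_ideal_primary Px Pxy => [m k|m k mk].
  by rewrite mdeg_inD; lia.
by congr (0 < _)%N; apply: eq_bigr.
Qed.

End VariablePrime.

End MonomialIdeals.

(** * Covers of a weighted oriented graph *)

Section Covers.

Variables (s : nat) (D : wograph s).
Implicit Types (m : 'X_{1..s}).

Local Notation arc := Defs.arc.
Local Notation w := (weight D).

Definition wcover m :=
  forall a b, arc D a b -> (0 < m a)%N || (w b <= m b)%N.

Definition double_wcover m :=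
  forall a b, arc D a b -> (2 <= m a + m b %/ w b)%N.

Lemma arc_neq a b : arc D a b -> a != b.
Proof.
move=> ab; apply: contraTneq ab => ->.
by apply/negP => bb; move: (arc_asym bb); rewrite bb.
Qed.

Lemma tail_weight1 a b : (forall i, i \in Vplus D -> is_sink D i) ->
  arc D a b -> w a = 1%N.
Proof.
move=> sinkV ab; apply/eqP; rewrite eqn_leq weight_gt0 andbT leqNgt.
by apply/negP => wa; have := sinkV a; rewrite inE wa => /(_ isT b); rewrite ab.
Qed.

Lemma wcover_up : up_closed wcover.
Proof. by move=> m k mC a b /mC; rewrite !mnmDE; lia. Qed.

Lemma sumset_wcover m : sumset wcover m -> double_wcover m.
Proof.
move=> [m1 [m2 [C1 C2 ->]]] a b ab; rewrite !mnmDE.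
have := C1 a b ab; have := C2 a b ab; have w0 := weight_gt0 D b.
case: (leqP (w b) (m1 b)) => h1; case: (leqP (w b) (m2 b)) => h2;
  rewrite ?orbT ?orbF => H2 H1.
- suff : (2 <= (m1 b + m2 b) %/ w b)%N by lia.
  by rewrite leq_divRL //; lia.
- suff : (1 <= (m1 b + m2 b) %/ w b)%N by lia.
  by rewrite leq_divRL //; lia.
- suff : (1 <= (m1 b + m2 b) %/ w b)%N by lia.
  by rewrite leq_divRL //; lia.
- exact: leq_trans (leq_add H1 H2) (leq_addr _ _).
Qed.

(** An exponent that is large off one arc is a cover as soon as it satisfies the
constraint of that arc, since no other arc has the same two endpoints. *)
Lemma wcover_arc m i j : arc D i j ->
  (forall v, v != i -> v != j -> (w v <= m v)%N) ->
  (0 < m i)%N || (w j <= m j)%N -> wcover m.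
Proof.
move=> ij mout mij a b ab; have [nab nij] := (arc_neq ab, arc_neq ij).
have [ai|ai] := eqVneq a i.
  have [bj|bj] := eqVneq b j; first by rewrite ai bj.
  by rewrite orbC mout // -ai eq_sym.
have [aj|aj] := eqVneq a j; last first.
  by apply/orP; left; apply: leq_trans (weight_gt0 D a) (mout _ ai aj).
have bi : b != i by apply: contraTneq ab => ->; rewrite aj (arc_asym ij).
by rewrite orbC mout // -aj eq_sym.
Qed.

(** After multiplication by a high power of the variables off the arc [(i, j)],
that is, after inverting them, only the constraint of this arc remains, and
each exponent that satisfies it splits. *)
Lemma double_wcover_local i j : arc D i j ->
  exists k : 'X_{1..s}, [/\ k i = 0%N, k j = 0%N &
    forall m, (2 <= m i + m j %/ w j)%N -> sumset wcover (k + m)%MM].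
Proof.
move=> ij; have nij := arc_neq ij; have wj := weight_gt0 D j.
exists [multinom (if (v == i) || (v == j) then 0 else 2 * w v)%N | v < s].
rewrite !mnmE !eqxx orbT; split=> // m mij.
(* [f] takes one unit on the arc, from [i] if possible. *)
pose f := [multinom if v == i then (0 < m i : nat) else
                    if v == j then (if m i == 0 then w j else 0)%N else
                    w v | v < s].
pose g := [multinom if v == i then (m i).-1 else
                    if v == j then (if m i == 0 then m j - w j else m j)%N else
                    (w v + m v)%N | v < s].
have mj : (m i < 2 -> w j <= m j)%N.
  by move=> mi; rewrite -[X in (X <= _)%N]mul1n -leq_divRL //; lia.
have mj2 : (m i = 0 -> 2 * w j <= m j)%N.
  by move=> mi; rewrite -leq_divRL //; lia.
have ji : (j == i) = false by rewrite eq_sym; apply: negPf.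
exists f, g; split.
- apply: (wcover_arc ij) => [v /negPf vi /negPf vj|]; first by
    rewrite mnmE vi vj.
  by rewrite !mnmE !eqxx ji; case: (m i) => [|k] /=; rewrite ?leqnn.
- apply: (wcover_arc ij) => [v /negPf vi /negPf vj|]; first by
    rewrite mnmE vi vj leq_addr.
  by rewrite !mnmE !eqxx ji; move: mj mj2; case: (m i) => [|[|k]] //=; lia.
- apply/mnmP => v; rewrite !mnmDE !mnmE.
  have [->|vi] := eqVneq v i; first by rewrite /=; lia.
  have [->|vj] := eqVneq v j; last by rewrite /=; lia.
  by move: mj2; case: (m i) => [|k] /=; lia.
Qed.

(** The exponent of a walk [i -> j -> k] through a vertex of weight at least
two is [1] at [i], [w j] at [j], and at [k] the least value permitted by a
possible arc between [i] and [k].  In any decomposition one summand vanishes at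
[i] and has to cover [i -> j] by the full weight of [j]; this leaves nothing at
[j] for the other summand, which then needs [w k] at [k] for the arc [j -> k].
The value at [k] is too small for that when [i] and [k] are not joined, and
otherwise it is too small to cover their arc by the first summand as well.  The
excluded triangles would decompose: there [2] at [k] is enough for both. *)
Lemma walk_obstruction i j k : arc D i j -> arc D j k -> (1 < w j)%N ->
  ~ [/\ arc D k i, (1 < w i)%N & w k = 1%N] ->
  exists2 m, double_wcover m & ~ sumset wcover m.
Proof.
move=> ij jk wj nki; have [nij njk] := (arc_neq ij, arc_neq jk).
have nki' : k != i by apply: contraTneq jk => ->; apply: arc_asym.
pose x := (if arc D i k then w k else
           if arc D k i then (if w i == 1 then 1 else 2) else 0)%N.
pose m := [multinom if v == i then 1%N else if v == j then w j else
                    if v == k then x else (2 * w v)%N | v < s].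
have [mi mj mk] : [/\ m i = 1%N, m j = w j & m k = x].
  by rewrite !mnmE !eqxx !(eq_sym j) (negPf nij) (negPf nki') (eq_sym k j)
             (negPf njk).
have mout v : v != i -> v != j -> v != k -> m v = (2 * w v)%N.
  by rewrite mnmE => /negPf-> /negPf-> /negPf->.
have wi := weight_gt0 D i; have wk := weight_gt0 D k.
exists m.
  move=> a b ab; have wa := weight_gt0 D a; have wb := weight_gt0 D b.
  have nab := arc_neq ab; have nba := arc_asym ab.
  case: (boolP (a \in [:: i; j; k])) => [|aout]; last first.
    move: aout; rewrite !inE !negb_or => /and3P[ai aj ak].
    by apply: leq_trans (leq_addr _ _); rewrite mout //; lia.
  case: (boolP (b \in [:: i; j; k])) => [|bout]; last first.
    move: bout; rewrite !inE !negb_or => /and3P[bi bj bk] _.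
    by rewrite (mout b) // mulnK // leq_addl.
  rewrite !inE => /or3P[]/eqP bE /or3P[]/eqP aE; subst a b;
    rewrite ?eqxx // in nab; rewrite ?mi ?mj ?mk ?divnn ?wj ?wk.
  - by rewrite ij in nba.
  - by rewrite /x (negPf nba) ab; case: eqP => [->|_].
  - by rewrite wb.
  - by rewrite jk in nba.
  - by rewrite /x ab divnn wk.
  - exact: leq_trans wj (leq_addr _ _).
(* By symmetry, [g] is the summand that vanishes at [i]. *)
suff no_split f g : wcover f -> wcover g -> m = (f + g)%MM -> g i = 0%N -> False.
  move=> [f [g [Cf Cg fgE]]]; have := mi; rewrite fgE mnmDE.
  case gi: (g i) => [|n]; first by rewrite addn0 => _; exact: (no_split f g).
  by move=> fi; apply: (no_split g f) => //; [rewrite addmC | lia].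
move=> Cf Cg fgE gi.
have fgi : (f i + g i = 1)%N by rewrite -mi fgE mnmDE.
have fgj : (f j + g j = w j)%N by rewrite -mj fgE mnmDE.
have fgk : (f k + g k = x)%N by rewrite -mk fgE mnmDE.
have gj : (w j <= g j)%N by have := Cg _ _ ij; rewrite gi.
have fk : (w k <= f k)%N by have /orP[|//] := Cf _ _ jk; lia.
have [ik|nik] := boolP (arc D i k).
  have gk : (w k <= g k)%N by have := Cg _ _ ik; rewrite gi.
  by move: fgk; rewrite /x ik; lia.
move: fgk; rewrite /x (negPf nik); have [ki|nki2] := boolP (arc D k i); last by lia.
have gk : (0 < g k)%N by have /orP[//|] := Cg _ _ ki; rewrite gi; lia.
case: eqP => [_|wi1]; first by lia.
suff : (1 < w k)%N by lia.
by rewrite ltn_neqAle wk andbT eq_sym; apply: contra_notN nki => /eqP; split=> //; lia.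
Qed.

(** The exponent vector [w] itself is a double cover once no tail of an arc has
weight above one; in a decomposition [w = f + g] no vertex can reach its full
weight in both summands, and one endpoint of each arc has to do so in each. *)
Lemma bipartite_of_split :
  (forall i, i \in Vplus D -> is_sink D i) ->
  (forall m, double_wcover m -> sumset wcover m) -> bipartite (underlying D).
Proof.
move=> sinkV split_dc.
have wtail a b : arc D a b -> w a = 1%N := tail_weight1 sinkV.
pose m := [multinom w v | v < s].
have [|f [g [Cf Cg fgE]]] := split_dc m.
  by move=> a b ab; rewrite !mnmE (wtail a b ab) divnn weight_gt0.
have fg v : (f v + g v = w v)%N by rewrite -mnmDE -fgE mnmE.
have arcA a b : arc D a b -> (w a <= f a)%N != (w b <= f b)%N.
  move=> ab; move: (Cf a b ab) (Cg a b ab) (fg a) (fg b) (weight_gt0 D b).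
  by rewrite (wtail a b ab); lia.
exists [set v | w v <= f v]%N => i j; rewrite !inE => /orP[/arcA//|/arcA].
by rewrite eq_sym.
Qed.

(** Measuring each exponent in units of the weight turns a double cover into a
vertex cover with multiplicity two.  Halving it, with the odd units rounded up
in one colour class and down in the other, leaves at least one unit on every
edge in both halves. *)
Lemma split_of_bipartite m :
  (forall i, i \in Vplus D -> is_sink D i) -> bipartite (underlying D) ->
  double_wcover m -> sumset wcover m.
Proof.
move=> sinkV [A bipA] dm.
have wtail a b : arc D a b -> w a = 1%N := tail_weight1 sinkV.
pose u v := (m v %/ w v)%N.
pose h v := if v \in A then uphalf (u v) else (u v)./2.
pose f := [multinom (h v * w v)%N | v < s].
have hu v : (h v <= u v)%N by rewrite /h; case: ifP => _; lia.
have fm v : (f v <= m v)%N.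
  by rewrite mnmE (leq_trans _ (leq_trunc_div (m v) (w v))) ?leq_mul.
have unit_cover (p : 'X_{1..s}) t : (forall v, t v * w v <= p v)%N ->
    (forall a b, arc D a b -> 0 < t a + t b)%N -> wcover p.
  move=> tp t_gt0 a b ab; have := t_gt0 a b ab.
  have := tp a; rewrite (wtail a b ab) muln1 => ta tab.
  case: (posnP (t b)) => [tb|tb]; first by lia.
  by rewrite orbC (leq_trans _ (tp b)) // leq_pmull.
have uab a b : arc D a b -> (2 <= u a + u b)%N.
  by move=> ab; rewrite {1}/u (wtail a b ab) divn1; apply: dm.
have bip a b : arc D a b -> (a \in A) != (b \in A).
  by move=> ab; apply: bipA; rewrite /underlying ab.
exists f, (m - f)%MM; split.
- apply: (unit_cover _ h) => [v|a b ab]; first by rewrite mnmE.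
  move: (uab a b ab) (bip a b ab); rewrite /h.
  by case: (a \in A); case: (b \in A) => //; lia.
- apply: (unit_cover _ (fun v => u v - h v)%N) => [v|a b ab].
    by rewrite mnmBE mnmE mulnBl leq_sub2r // leq_trunc_div.
  move: (uab a b ab) (bip a b ab); rewrite /h.
  by case: (a \in A); case: (b \in A) => //; lia.
by apply/mnmP => v; rewrite mnmDE mnmBE subnKC.
Qed.

End Covers.

(** * The dual ideal and its symbolic square *)

Section DualIdeal.

Variables (K : fieldType) (s : nat) (D : wograph s).

Local Notation arc := Defs.arc.
Local Notation w := (weight D).
Local Notation J := (dual_ideal K s D).
Local Notation edge_prime i j := (@variable_prime K s [set i; j]).

Lemma dual_ideal_monomial : ideal_eq J (monomial_ideal (wcover D)).
Proof.
move=> f; split=> [Jf m fm a b ab|Cf a b ab].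
  by have /monomial_ideal_gen2/(_ m fm) := Jf a b ab.
by apply/monomial_ideal_gen2 => m fm; apply: Cf.
Qed.

Lemma mdeg_in2 i j (m : 'X_{1..s}) :
  i != j -> mdeg_in [set i; j] m = (m i + m j)%N.
Proof. by move=> nij; rewrite /mdeg_in big_setU1 ?inE // big_set1. Qed.

(** The vertices whose variables avoid a prime [P] cannot form a vertex cover
when [P] contains [J]: the monomial with exponent [w] on them would be in [J]. *)
Lemma prime_over_dual (P : {mpoly K[s]} -> Prop) :
  prime_ideal P -> ideal_le J P ->
  exists i j, arc D i j /\ ideal_le (edge_prime i j) P.
Proof.
move=> primeP JP; have [idP P1 PM] := primeP; have [_ _ idM] := idP.
suff [i [j [ij Pi Pj]]] : exists i j, [/\ arc D i j, P 'X_i & P 'X_j].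
  exists i, j; split=> //; apply: monomial_ideal_le => // m.
  rewrite mdeg_in2 ?(arc_neq ij) // => mij.
  have [mi|mj] : (0 < m i)%N \/ (0 < m j)%N by lia.
    have -> : m = (m - U_(i) + U_(i))%MM.
      by apply/mnmP => v; rewrite mnmDE mnmBE mnm1E; case: eqP => [<-|_]; lia.
    by rewrite mpolyXD; apply: idM.
  have -> : m = (m - U_(j) + U_(j))%MM.
    by apply/mnmP => v; rewrite mnmDE mnmBE mnm1E; case: eqP => [<-|_]; lia.
  by rewrite mpolyXD; apply: idM.
apply: NNPP => no_arc.
pose inP v : bool := excluded_middle_informative (P 'X_v).
have inPP v : reflect (P 'X_v) (inP v).
  by rewrite /inP; case: excluded_middle_informative => h; constructor.
pose m := [multinom if inP v then 0%N else w v | v < s].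
have Pm : P 'X_[m].
  apply/JP/dual_ideal_monomial/monomial_ideal_X => a b ab; rewrite !mnmE.
  case: (inPP a) => Pa; last by rewrite weight_gt0.
  case: (inPP b) => Pb; last by rewrite leqnn orbT.
  by case: no_arc; exists a, b.
move: Pm; rewrite mpolyXE_id; apply: prime_ideal_prod => // v.
rewrite mnmE; case: (inPP v) => [_|Pv]; first by rewrite expr0.
by move/(prime_ideal_exp primeP).
Qed.

(** The residue class with this annihilator is that of a monomial which misses
the component of the arc by one factor [X_j] and lies in those of all other
arcs. *)
Lemma edge_prime_associated i j : arc D i j ->
  associated_prime J (edge_prime i j).
Proof.
move=> ij; have nij := arc_neq ij; have wj := weight_gt0 D j.
split; first exact: variable_prime_prime.
pose m := [multinom if v == i then 0%N else
                    if v == j then (w j).-1 else w v | v < s].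
have mi : m i = 0%N by rewrite mnmE eqxx.
have mj : m j = (w j).-1 by rewrite mnmE eq_sym (negPf nij) eqxx.
exists 'X_[m] => f; rewrite (monomial_ideal_colonX _ _ dual_ideal_monomial).
split=> Pf k fk.
  apply: (wcover_arc ij) => [v vi vj|].
    by rewrite mnmDE mnmE (negPf vi) (negPf vj) leq_addr.
  by have := Pf k fk; rewrite mdeg_in2 // !mnmDE mi mj; lia.
by have := Pf k fk i j ij; rewrite mdeg_in2 // !mnmDE mi mj; lia.
Qed.

Lemma associated_prime_over (P : {mpoly K[s]} -> Prop) :
  associated_prime J P -> exists i j, arc D i j /\ ideal_le (edge_prime i j) P.
Proof.
move=> [primeP [f Pf]]; apply: prime_over_dual => // x Jx; apply/Pf.
have [_ _ JM] : is_ideal (monomial_ideal (K := K) (wcover D)).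
  by apply/monomial_idealP/wcover_up.
by apply/dual_ideal_monomial; rewrite mulrC; apply/JM/dual_ideal_monomial.
Qed.

Lemma edge_prime_X i j v :
  i != j -> edge_prime i j 'X_v <-> v = i \/ v = j.
Proof.
move=> nij; rewrite /variable_prime monomial_ideal_X mdeg_in2 // !mnm1E.
by split=> [|[]->]; rewrite ?eqxx ?addnS //; case: eqP => [|_]; case: eqP; auto.
Qed.

Lemma edge_prime_inj i j k l : arc D i j -> arc D k l ->
  ideal_le (edge_prime k l) (edge_prime i j) -> k = i /\ l = j.
Proof.
move=> ij kl le_kl; have nij := arc_neq ij; have nkl := arc_neq kl.
have Xk : edge_prime k l 'X_k by apply/edge_prime_X; auto.
have Xl : edge_prime k l 'X_l by apply/edge_prime_X; auto.
move: (le_kl _ Xk) (le_kl _ Xl).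
move=> /edge_prime_X-/(_ nij)[]kE /edge_prime_X-/(_ nij)[]lE; subst k l => //;
  rewrite ?eqxx // in nkl.
by have := arc_asym ij; rewrite kl.
Qed.

(** Distinct arcs have incomparable primes, so none of the associated primes is
embedded. *)
Lemma min_associated_primeP (P : {mpoly K[s]} -> Prop) :
  min_associated_prime J P <->
  exists i j, arc D i j /\ ideal_eq P (edge_prime i j).
Proof.
split=> [[assP minP]|[i [j [ij PE]]]].
  have [i [j [ij leP]]] := associated_prime_over assP.
  exists i, j; split=> // x; split; last exact: leP.
  exact: minP (edge_prime_associated ij) leP x.
have [primeE [f fE]] := edge_prime_associated ij.
have [[E0 ED EM] E1 EP] := primeE.
split.
  split; last by exists f => x; rewrite PE.
  split; first split.
  - exact/PE.
  - by move=> x y /PE Ex /PE Ey; apply/PE/ED.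
  - by move=> a x /PE Ex; apply/PE/EM.
  - by move/PE.
  - by move=> x y /PE/EP[]Ex; [left | right]; apply/PE.
move=> Q assQ leQ x /PE Ex.
have [k [l [kl leE]]] := associated_prime_over assQ.
have [ki lj] : k = i /\ l = j.
  by apply: edge_prime_inj => // y /leE/leQ/PE.
by apply: leE; rewrite ki lj.
Qed.

Lemma dual_ideal_sqr :
  ideal_eq (ideal_pow J 2) (monomial_ideal (sumset (wcover D))).
Proof. exact: monomial_ideal_sqr (@wcover_up _ D) dual_ideal_monomial. Qed.

(** The localization at the prime of an arc sees only the constraint of that
arc, and contracting the square back to the polynomial ring adds nothing,
because the square of the component of the arc is primary. *)
Lemma symbolic_square :
  ideal_eq (symbolic_power J 2) (monomial_ideal (double_wcover D)).
Proof.
have idJ2 : is_ideal (ideal_pow J 2) by apply: ideal_powP.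
move=> f; split=> [symf m fm i j ij|dcf P].
  have minE : min_associated_prime J (edge_prime i j).
    by apply/min_associated_primeP; exists i, j.
  have primeE : prime_ideal (edge_prime i j) by apply: variable_prime_prime.
  have [b Eb J2bf] := iffLR (extended_idealP _ primeE idJ2) (symf _ minE).
  pose U (m : 'X_{1..s}) := (2 <= m i + m j %/ w j)%N.
  apply: (monomial_ideal_primary (U := U) _ _ Eb) (fm) => [k l|k l kl|k bfk].
  - rewrite /U !mnmDE => /leq_trans-> //.
    by rewrite leq_add ?leq_addl ?leq_div2r ?leq_addl.
  - by rewrite /U !kl ?inE ?eqxx ?orbT.
  - by apply: (sumset_wcover (D := D)) ij; exact: iffLR (dual_ideal_sqr _) J2bf k bfk.
move=> minP; have [[primeP _] _] := minP.
have [i [j [ij PE]]] := iffLR (min_associated_primeP P) minP.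
have [k [ki kj splitk]] := double_wcover_local ij.
apply/extended_idealP => //; exists 'X_[k].
  by move/PE/monomial_ideal_X; rewrite mdeg_in2 ?(arc_neq ij) // ki kj.
rewrite mulrC; apply/(monomial_ideal_colonX k f dual_ideal_sqr) => m fm.
exact/splitk/dcf.
Qed.

Lemma symbolic_square_eq :
  ideal_eq (ideal_pow J 2) (symbolic_power J 2) <->
  forall m, double_wcover D m -> sumset (wcover D) m.
Proof.
split=> [eqJ m dm|splitD f].
  by apply/(@monomial_ideal_X K)/dual_ideal_sqr/eqJ/symbolic_square/monomial_ideal_X.
rewrite dual_ideal_sqr symbolic_square.
by split=> Uf m /Uf; [apply: sumset_wcover | apply: splitD].
Qed.

End DualIdeal.

Theorem theorem7p4 (K : fieldType) (s : nat) (D : wograph s)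
    (hsource : forall i : 'I_s, is_source D i -> weight D i = 1%N) :
  ideal_eq (ideal_pow (dual_ideal K s D) 2) (symbolic_power (dual_ideal K s D) 2)
  <->
  ((forall i : 'I_s, i \in Vplus D -> is_sink D i) /\ bipartite (underlying D)).
Proof.
rewrite symbolic_square_eq; split=> [splitD|[sinkV bipD] m]; last first.
  exact: split_of_bipartite.
suff sinkV : forall i, i \in Vplus D -> is_sink D i.
  by split=> //; apply: bipartite_of_split.
move=> j; rewrite inE => wj k; apply/negP => jk.
have no_obstruction : ~ (exists2 m, double_wcover D m & ~ sumset (wcover D) m).
  by case=> m /splitD.
have [i ij] : exists i, Defs.arc D i j.
  apply: NNPP => no_arc; move: wj; rewrite hsource // => i.
  by apply/negP => ij; apply: no_arc; exists i.
apply: no_obstruction.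
(* In the triangle excluded for [i -> j -> k], the walk [k -> i -> j] works. *)
case: (boolP [&& Defs.arc D k i, 1 < weight D i & weight D k == 1]%N).
  move=> /and3P[ki wi /eqP wk]; apply: (walk_obstruction ki ij wi).
  by case=> _; rewrite wk.
move=> /and3P triangle; apply: (walk_obstruction ij jk wj).
by case=> ki wi /eqP wk; apply: triangle.
Qed.
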